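(* Let $\Bbbk$ be an algebraically closed field of characteristic zero, let $A$ be a finite-dimensional $\Bbbk$-algebra and let $F:A\text{-mod}\to A\text{-mod}$ be a right exact ($\Bbbk$-linear) endofunctor. If $F$ is $\otimes$-representable by a finitely generated $A$-bimodule $B$, then $\mathfrak{L}_F(A\text{-mod})$ is isomorphic to $\mathfrak{L}_{B\otimes_A(-)}(A\text{-mod})$.
   Context: $A\text{-mod}$ is the category of finitely generated left $A$-modules. An endofunctor $F$ of $A\text{-mod}$ is $\otimes$-representable by an $A$-$A$-bimodule $B$ if $F$ is naturally isomorphic to $B\otimes_A-$. For an endofunctor $F$ of an additive category $\mathcal{C}$, the category $\mathfrak{L}_F(\mathcal{C})$ has as objects the families $M=(M^n,d_M^n)_{n\in\mathbb{Z}}$ of objects $M^n$ of $\mathcal{C}$ and morphisms $d_M^n:F(M^n)\to M^{n+1}$ with $d_M^{n+1}\circ F(d_M^n)=0$ for all $n$. A morphism $\varphi:M\to N$ is a family $(\varphi^n:M^n\to N^n)_{n\in\mathbb{Z}}$ with $\varphi^{n+1}\circ d_M^n=d_N^n\circ F(\varphi^n)$ for all $n$. The paper refers to $\mathfrak{L}_{B\otimes_A(-)}(A\text{-mod})$ loosely as ''the repetitive algebra generated by $B$''. *)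

(* Defs.v *)
From HB Require Import structures.
From mathcomp Require Import all_boot all_order all_algebra all_field.
From mathcomp Require Import boolp.

Set Implicit Arguments.
Unset Strict Implicit.
Unset Printing Implicit Defensive.

Import GRing.Theory.
Local Open Scope ring_scope.
Local Open Scope quotient_scope.

Record category := Category {
  obj :> Type;
  arrow : obj -> obj -> Type;
  idarr : forall X, arrow X X;
  ccomp : forall X Y Z, arrow Y Z -> arrow X Y -> arrow X Z;
  ccompA : forall W X Y Z (h : arrow Y Z) (g : arrow X Y) (f : arrow W X),
    ccomp h (ccomp g f) = ccomp (ccomp h g) f;
  ccomp1m : forall X Y (f : arrow X Y), ccomp (idarr Y) f = f;
  ccompm1 : forall X Y (f : arrow X Y), ccomp f (idarr X) = f
}.
Arguments arrow {c} X Y.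
Arguments idarr {c} X.
Arguments ccomp {c X Y Z} g f : rename.

Declare Scope cat_scope.
Delimit Scope cat_scope with cat.
Local Open Scope cat_scope.
Notation "g \oc f" := (ccomp g f) (at level 40, left associativity) : cat_scope.

Record functor (C D : category) := Functor {
  fobj :> C -> D;
  fmap : forall X Y : C, arrow X Y -> arrow (fobj X) (fobj Y);
  fmap1 : forall X, fmap (idarr X) = idarr (fobj X);
  fmapM : forall X Y Z (g : arrow Y Z) (f : arrow X Y),
    fmap (g \oc f) = fmap g \oc fmap f
}.
Arguments fmap {C D} f {X Y} u : rename.

Section FunctorOps.
Variables C D E : category.

Definition idF : functor C C :=
  @Functor C C (fun X => X) (fun _ _ f => f) (fun _ => erefl) (fun _ _ _ _ _ => erefl).

Variables (G : functor D E) (F : functor C D).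

Fact compF1 X : fmap G (fmap F (idarr X)) = idarr (G (F X)).
Proof. by rewrite !fmap1. Qed.

Fact compFM X Y Z (g : arrow Y Z) (f : arrow X Y) :
  fmap G (fmap F (g \oc f)) = fmap G (fmap F g) \oc fmap G (fmap F f).
Proof. by rewrite !fmapM. Qed.

Definition compF : functor C E :=
  @Functor C E (fun X => G (F X)) (fun _ _ f => fmap G (fmap F f)) compF1 compFM.
End FunctorOps.
Arguments idF C : clear implicits.

(* Isomorphism of categories in the strict sense (not merely equivalence);
   the equalities are Leibniz equalities of functors. *)
Definition isomorphic_categories (C D : category) : Prop :=
  exists (G : functor C D) (H : functor D C),
    compF H G = idF C /\ compF G H = idF D.

Definition naturally_isomorphic (C D : category) (F G : functor C D) : Prop :=
  exists (eta : forall X, arrow (F X) (G X)) (theta : forall X, arrow (G X) (F X)),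
    [/\ forall X Y (f : arrow X Y), eta Y \oc fmap F f = fmap G f \oc eta X,
        forall X, theta X \oc eta X = idarr (F X)
      & forall X, eta X \oc theta X = idarr (G X)].

Record additiveCategory := AdditiveCategory {
  aobj : Type;
  addarrow : aobj -> aobj -> zmodType;
  aidm : forall X, addarrow X X;
  acomp : forall X Y Z, addarrow Y Z -> addarrow X Y -> addarrow X Z;
  acompA : forall W X Y Z (h : addarrow Y Z) (g : addarrow X Y) (f : addarrow W X),
    acomp h (acomp g f) = acomp (acomp h g) f;
  acomp1m : forall X Y (f : addarrow X Y), acomp (aidm Y) f = f;
  acompm1 : forall X Y (f : addarrow X Y), acomp f (aidm X) = f;
  acompDl : forall X Y Z (g h : addarrow Y Z) (f : addarrow X Y),
    acomp (g + h) f = acomp g f + acomp h f;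
  acompDr : forall X Y Z (h : addarrow Y Z) (f g : addarrow X Y),
    acomp h (f + g) = acomp h f + acomp h g;
  azero : exists Z, aidm Z = 0;
  abiprod : forall X Y, exists P (i1 : addarrow X P) (i2 : addarrow Y P)
                          (p1 : addarrow P X) (p2 : addarrow P Y),
    [/\ acomp p1 i1 = aidm X, acomp p2 i2 = aidm Y,
        acomp p1 i2 = 0, acomp p2 i1 = 0
      & acomp i1 p1 + acomp i2 p2 = aidm P]
}.

Definition category_of_additive (C : additiveCategory) : category :=
  Category (@acompA C) (@acomp1m C) (@acompm1 C).
Coercion category_of_additive : additiveCategory >-> category.

Section LF.
Variables (C : additiveCategory) (F : functor C C).

Record Lobj := LObj {
  Lfam :> int -> C;
  Ld : forall n : int, arrow (F (Lfam n)) (Lfam (n + 1));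
  LdK : forall n : int,
    Ld (n + 1) \oc fmap F (Ld n) = 0 :> addarrow (F (F (Lfam n))) (Lfam (n + 1 + 1))
}.

Record Lhom (M N : Lobj) := LHom {
  Lmor :> forall n : int, arrow (M n) (N n);
  LmorP : forall n : int, Lmor (n + 1) \oc Ld M n = Ld N n \oc fmap F (Lmor n)
}.

Lemma Lhom_ext (M N : Lobj) (f g : Lhom M N) : (forall n, f n = g n) -> f = g.
Proof.
case: f g => f fP [g gP] /= fg.
have e : f = g by apply: functional_extensionality_dep.
by case: g / e gP fg => gP _; congr LHom; apply: Prop_irrelevance.
Qed.

Fact Lid_subproof (M : Lobj) (n : int) :
  idarr (M (n + 1)) \oc Ld M n = Ld M n \oc fmap F (idarr (M n)).
Proof. by rewrite fmap1 ccomp1m ccompm1. Qed.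

Definition Lid (M : Lobj) : Lhom M M := LHom (@Lid_subproof M).

Fact Lcomp_subproof (M N P : Lobj) (g : Lhom N P) (f : Lhom M N) (n : int) :
  (g (n + 1) \oc f (n + 1)) \oc Ld M n = Ld P n \oc fmap F (g n \oc f n).
Proof. by rewrite fmapM -ccompA LmorP ccompA LmorP ccompA. Qed.

Definition Lcomp (M N P : Lobj) (g : Lhom N P) (f : Lhom M N) : Lhom M P :=
  LHom (Lcomp_subproof g f).

Fact LcompA (W X Y Z : Lobj) (h : Lhom Y Z) (g : Lhom X Y) (f : Lhom W X) :
  Lcomp h (Lcomp g f) = Lcomp (Lcomp h g) f.
Proof. by apply: Lhom_ext => n; apply: ccompA. Qed.

Fact Lcomp1m (X Y : Lobj) (f : Lhom X Y) : Lcomp (Lid Y) f = f.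
Proof. by apply: Lhom_ext => n; apply: ccomp1m. Qed.

Fact Lcompm1 (X Y : Lobj) (f : Lhom X Y) : Lcomp f (Lid X) = f.
Proof. by apply: Lhom_ext => n; apply: ccompm1. Qed.

Definition Lcat : category := Category LcompA Lcomp1m Lcompm1.
End LF.

Section ModHom.
Variables (k : fieldType) (A : falgType k).

Definition modhom (M N : lmodType A) : Type := {linear M -> N}.

Section Fixed.
Variables M N : lmodType A.
Implicit Types f g : modhom M N.

Lemma modhom_ext f g : (forall x, f x = g x) -> f = g.
Proof.
case: f g => f [[fN] [fS]] [g [[gN] [gS]]] /= fg.
have e : f = g by apply: funext.
case: g / e gN gS fg => gN gS _.
by rewrite (Prop_irrelevance gN fN) (Prop_irrelevance gS fS).
Qed.

(* A need not be commutative, so only the scalars of k act on homs, through c%:A. *)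
Lemma scalar_comm (c : k) (a : A) (x : N) : c%:A *: (a *: x) = a *: (c%:A *: x).
Proof. by rewrite !scalerA -scalerAl -scalerAr mul1r mulr1. Qed.

Fact mh0_linear : linear (fun _ : M => 0 : N).
Proof. by move=> a x y; rewrite scaler0 addr0. Qed.
Fact mhD_linear f g : linear (fun x => f x + g x).
Proof. by move=> a x y; rewrite !linearP scalerDr addrACA. Qed.
Fact mhN_linear f : linear (fun x => - f x).
Proof. by move=> a x y; rewrite linearP opprD scalerN. Qed.
Fact mhZ_linear (c : k) f : linear (fun x => c%:A *: f x).
Proof. by move=> a x y; rewrite linearP scalerDr scalar_comm. Qed.

Definition mk_modhom (f : M -> N) (lf : linear f) : modhom M N :=
  HB.pack f (GRing.isLinear.Build A M N *:%R f lf).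

Definition mh0 := mk_modhom mh0_linear.
Definition mhD f g := mk_modhom (mhD_linear f g).
Definition mhN f := mk_modhom (mhN_linear f).
Definition mhZ (c : k) f := mk_modhom (mhZ_linear c f).

HB.instance Definition _ := gen_eqMixin (modhom M N).
HB.instance Definition _ := gen_choiceMixin (modhom M N).

Fact mhDA : associative mhD.
Proof. by move=> f g h; apply: modhom_ext => x; apply: addrA. Qed.
Fact mhDC : commutative mhD.
Proof. by move=> f g; apply: modhom_ext => x; apply: addrC. Qed.
Fact mh0D : left_id mh0 mhD.
Proof. by move=> f; apply: modhom_ext => x; apply: add0r. Qed.
Fact mhND : left_inverse mh0 mhN mhD.
Proof. by move=> f; apply: modhom_ext => x; apply: addNr. Qed.

HB.instance Definition _ := GRing.isZmodule.Build (modhom M N) mhDA mhDC mh0D mhND.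

Fact mhZA (a b : k) f : mhZ a (mhZ b f) = mhZ (a * b) f.
Proof.
by apply: modhom_ext => x /=; rewrite scalerA -scalerAl mul1r scalerA.
Qed.
Fact mhZ1 : left_id 1 mhZ.
Proof. by move=> f; apply: modhom_ext => x /=; rewrite !scale1r. Qed.
Fact mhZDr : right_distributive mhZ +%R.
Proof. by move=> c f g; apply: modhom_ext => x /=; rewrite scalerDr. Qed.
Fact mhZDl f : {morph mhZ^~ f : a b / a + b}.
Proof. by move=> a b; apply: modhom_ext => x /=; rewrite !scalerDl. Qed.

HB.instance Definition _ :=
  GRing.Zmodule_isLmodule.Build k (modhom M N) mhZA mhZ1 mhZDr mhZDl.
End Fixed.

Fact mhid_linear (M : lmodType A) : linear (fun x : M => x).
Proof. by []. Qed.
Definition mhid (M : lmodType A) : modhom M M := mk_modhom (@mhid_linear M).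

Fact mhcomp_linear (M N P : lmodType A) (g : modhom N P) (f : modhom M N) :
  linear (fun x => g (f x)).
Proof. by move=> a x y; rewrite !linearP. Qed.
Definition mhcomp (M N P : lmodType A) (g : modhom N P) (f : modhom M N) : modhom M P :=
  mk_modhom (mhcomp_linear g f).

Definition finitely_generated (M : lmodType A) : Prop :=
  exists (n : nat) (g : 'I_n -> M),
    forall x : M, exists a : 'I_n -> A, x = \sum_(i < n) a i *: g i.

Lemma fg_finType (M : lmodType A) (I : finType) (g : I -> M) :
  (forall x : M, exists a : I -> A, x = \sum_i a i *: g i) -> finitely_generated M.
Proof.
move=> gP; exists #|I|, (g \o enum_val) => x; have [a ->] := gP x.
exists (a \o enum_val); rewrite (reindex (@enum_val I predT)) /=; first by [].
by apply: onW_bij; apply: enum_val_bij.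
Qed.

Record fgmodule := FGModule {
  fgsort :> lmodType A;
  fgP : finitely_generated fgsort
}.

Definition modhom_fg (M N : fgmodule) : lmodType k := modhom M N.

Fact fg_zero : finitely_generated 'rV[A]_0.
Proof.
by exists 0, (fun=> 0) => x; exists (fun=> 0); rewrite big_ord0 thinmx0.
Qed.

Fact fg_prod (M N : lmodType A) :
  finitely_generated M -> finitely_generated N -> finitely_generated (M * N)%type.
Proof.
move=> [m [g gP]] [n [h hP]].
exists (m + n)%N, (fun i => match split i with inl j => (g j, 0) | inr j => (0, h j) end).
move=> [x y]; have [a ->] := gP x; have [b ->] := hP y.
exists (fun i => match split i with inl j => a j | inr j => b j end).
have El i : split (lshift n i : 'I_(m + n)) = inl i by exact: (unsplitK (inl i)).
have Er i : split (rshift m i : 'I_(m + n)) = inr i by exact: (unsplitK (inr i)).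
rewrite big_split_ord /=.
under [X in _ = X + _]eq_bigr => i _ do rewrite El.
under [X in _ = _ + X]eq_bigr => i _ do rewrite Er.
apply/pair_equal_spec; rewrite /= !raddf_sum /=; split.
- by rewrite [X in _ + X]big1 ?addr0// => i _; rewrite scaler0.
- by rewrite [X in X + _]big1 ?add0r// => i _; rewrite scaler0.
Qed.

End ModHom.

Section Amod.
Variables (k : fieldType) (A : falgType k).
Implicit Types W X Y Z M N P : fgmodule A.

Definition mid X : modhom_fg X X := mhid X.
Definition mcomp X Y Z (g : modhom_fg Y Z) (f : modhom_fg X Y) : modhom_fg X Z :=
  mhcomp (g : modhom Y Z) (f : modhom X Y).

Fact mcompA W X Y Z (h : modhom_fg Y Z) (g : modhom_fg X Y) (f : modhom_fg W X) :
  mcomp h (mcomp g f) = mcomp (mcomp h g) f.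
Proof. exact: modhom_ext. Qed.
Fact mcomp1m X Y (f : modhom_fg X Y) : mcomp (mid Y) f = f.
Proof. exact: modhom_ext. Qed.
Fact mcompm1 X Y (f : modhom_fg X Y) : mcomp f (mid X) = f.
Proof. exact: modhom_ext. Qed.
Fact mcompDl X Y Z (g h : modhom_fg Y Z) (f : modhom_fg X Y) :
  mcomp (g + h) f = mcomp g f + mcomp h f.
Proof. exact: modhom_ext. Qed.
Fact mcompDr X Y Z (h : modhom_fg Y Z) (f g : modhom_fg X Y) :
  mcomp h (f + g) = mcomp h f + mcomp h g.
Proof. by apply: modhom_ext => x; apply: (linearD (h : modhom Y Z)). Qed.

Fact Amod_zero : exists Z, mid Z = 0.
Proof.
by exists (FGModule (fg_zero A)); apply: modhom_ext => x /=; rewrite [LHS]thinmx0.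
Qed.

Fact Amod_biprod X Y : exists P (i1 : modhom_fg X P) (i2 : modhom_fg Y P)
    (p1 : modhom_fg P X) (p2 : modhom_fg P Y),
  [/\ mcomp p1 i1 = mid X, mcomp p2 i2 = mid Y,
      mcomp p1 i2 = 0, mcomp p2 i1 = 0
    & mcomp i1 p1 + mcomp i2 p2 = mid P].
Proof.
have l1 : linear (fun x : X => (x, 0 : Y)).
  by move=> a x y; apply/pair_equal_spec; rewrite /= scaler0 addr0.
have l2 : linear (fun y : Y => (0 : X, y)).
  by move=> a x y; apply/pair_equal_spec; rewrite /= scaler0 addr0.
have l3 : linear (fun p : X * Y => p.1) by [].
have l4 : linear (fun p : X * Y => p.2) by [].
exists (FGModule (fg_prod (fgP X) (fgP Y))), (mk_modhom l1), (mk_modhom l2),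
  (mk_modhom l3), (mk_modhom l4).
split; apply: modhom_ext => //= -[x y].
by apply/pair_equal_spec; rewrite /= addr0 add0r.
Qed.

Definition Amod : additiveCategory :=
  AdditiveCategory mcompA mcomp1m mcompm1 mcompDl mcompDr Amod_zero Amod_biprod.

Definition klinear_functor (F : functor Amod Amod) : Prop :=
  forall M N, linear (fmap F : modhom_fg M N -> modhom_fg (F M) (F N)).

Definition surjective_hom M N (f : modhom_fg M N) : Prop :=
  forall y : N, exists x : M, f x = y.

Definition exact_at M N P (f : modhom_fg M N) (g : modhom_fg N P) : Prop :=
  forall y : N, g y = 0 <-> exists x : M, f x = y.

Definition right_exact (F : functor Amod Amod) : Prop :=
  forall M N P (f : modhom_fg M N) (g : modhom_fg N P),
    exact_at f g -> surjective_hom g ->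
    exact_at (fmap F f : modhom_fg (F M) (F N)) (fmap F g : modhom_fg (F N) (F P))
    /\ surjective_hom (fmap F g : modhom_fg (F N) (F P)).
End Amod.

(* As usual over a k-algebra, the two induced k-actions on a bimodule agree. *)
Record bimodule (k : fieldType) (A : falgType k) := Bimodule {
  bsort :> lmodType A;
  rmulact : bsort -> A -> bsort;
  ractDl : forall x y a, rmulact (x + y) a = rmulact x a + rmulact y a;
  ractDr : forall x a b, rmulact x (a + b) = rmulact x a + rmulact x b;
  ract1 : forall x, rmulact x 1 = x;
  ractM : forall x a b, rmulact x (a * b) = rmulact (rmulact x a) b;
  lractA : forall a x b, rmulact (a *: x) b = a *: rmulact x b;
  ract_scalar : forall (c : k) x, rmulact x c%:A = c%:A *: x
}.
Arguments rmulact {k A b} x a : rename.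

Definition bimodule_fg (k : fieldType) (A : falgType k) (B : bimodule A) : Prop :=
  exists (n : nat) (g : 'I_n -> B), forall x : B,
    exists (r : nat) (j : 'I_r -> 'I_n) (a a' : 'I_r -> A),
      x = \sum_(i < r) a i *: rmulact (g (j i)) (a' i).

Section Tensor.
Variables (k : fieldType) (A : falgType k) (B : bimodule A) (M : lmodType A).

(* A list [:: (b1, m1); ...; (br, mr)] stands for the sum of the bi (x) mi. The
   congruence below presents a commutative monoid, which is a group because
   (b, m) + (- b, m) ~ (0, m) ~ 0. *)
Inductive tens_rel : seq (B * M) -> seq (B * M) -> Prop :=
| tens_refl s : tens_rel s s
| tens_sym s t : tens_rel s t -> tens_rel t s
| tens_trans s t u : tens_rel s t -> tens_rel t u -> tens_rel s u
| tens_cat s s' t t' : tens_rel s s' -> tens_rel t t' -> tens_rel (s ++ t) (s' ++ t')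
| tens_comm s t : tens_rel (s ++ t) (t ++ s)
| tens_zero m : tens_rel [:: (0, m)] [::]
| tens_addl b b' m : tens_rel [:: (b + b', m)] [:: (b, m); (b', m)]
| tens_addr b m m' : tens_rel [:: (b, m + m')] [:: (b, m); (b, m')]
| tens_bal b a m : tens_rel [:: (rmulact b a, m)] [:: (b, a *: m)].

Definition tens_eqv (s t : seq (B * M)) : bool := `[< tens_rel s t >].

Fact tens_eqv_refl : reflexive tens_eqv.
Proof. by move=> s; apply/asboolP; apply: tens_refl. Qed.
Fact tens_eqv_sym : symmetric tens_eqv.
Proof.
by move=> s t; apply/asboolP/asboolP; apply: tens_sym.
Qed.
Fact tens_eqv_trans : transitive tens_eqv.
Proof.
by move=> t s u /asboolP st /asboolP tu; apply/asboolP; apply: tens_trans tu.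
Qed.
Canonical tens_equiv := EquivRel tens_eqv tens_eqv_refl tens_eqv_sym tens_eqv_trans.

Definition tensor : Type := {eq_quot tens_equiv}.
HB.instance Definition _ := Choice.on tensor.

Definition tens_class (s : seq (B * M)) : tensor := \pi_({eq_quot tens_equiv}) s.
Definition tens_repr (x : tensor) : seq (B * M) := repr (x : {eq_quot tens_equiv}).

Lemma tens_classK x : tens_class (tens_repr x) = x.
Proof. exact: reprK. Qed.

Lemma tens_classP s t : tens_class s = tens_class t <-> tens_rel s t.
Proof.
split=> [/eqP|st]; first by rewrite /tens_class eqmodE => /asboolP.
by apply/eqP; rewrite /tens_class eqmodE; apply/asboolP.
Qed.

Lemma tens_reprK s : tens_rel (tens_repr (tens_class s)) s.
Proof. by apply/tens_classP; rewrite tens_classK. Qed.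

Definition pure (b : B) (m : M) : tensor := tens_class [:: (b, m)].
Definition tadd (x y : tensor) : tensor := tens_class (tens_repr x ++ tens_repr y).
Definition topp (x : tensor) : tensor :=
  tens_class [seq (- p.1, p.2) | p <- tens_repr x].

Lemma tadd_class s t : tadd (tens_class s) (tens_class t) = tens_class (s ++ t).
Proof. by apply/tens_classP; apply: tens_cat; apply: tens_reprK. Qed.

Fact taddA : associative tadd.
Proof.
move=> x y z; rewrite -(tens_classK x) -(tens_classK y) -(tens_classK z).
by rewrite !tadd_class catA.
Qed.
Fact taddC : commutative tadd.
Proof. by move=> x y; apply/tens_classP; apply: tens_comm. Qed.
Fact tadd0 : left_id (tens_class [::]) tadd.
Proof. by move=> x; rewrite -(tens_classK x) tadd_class. Qed.
Fact taddN : left_inverse (tens_class [::]) topp tadd.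
Proof.
move=> x; rewrite -{2}(tens_classK x) /topp; elim: (tens_repr x) => [|[b m] s IHs] /=.
  by rewrite tadd0.
have E q t : tens_class (q :: t) = tadd (tens_class [:: q]) (tens_class t).
  by rewrite tadd_class.
have AC u v w z : tadd (tadd u v) (tadd w z) = tadd (tadd u w) (tadd v z).
  by rewrite -!taddA; congr tadd; rewrite !taddA (taddC v).
rewrite E [X in tadd _ X]E AC IHs taddC tadd0 tadd_class; apply/tens_classP.
apply: tens_trans (tens_zero m); rewrite -(addNr b).
by apply: tens_sym; apply: tens_addl.
Qed.

HB.instance Definition _ := GRing.isZmodule.Build tensor taddA taddC tadd0 taddN.

Lemma tens_classE s : tens_class s = \sum_(p <- s) pure p.1 p.2.
Proof.
elim: s => [|[b m] s IHs]; first by rewrite big_nil.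
by rewrite big_cons -IHs -[RHS]/(tadd _ _) tadd_class.
Qed.

Lemma tensE (x : tensor) : x = \sum_(p <- tens_repr x) pure p.1 p.2.
Proof. by rewrite -tens_classE tens_classK. Qed.

Lemma pureDl b b' m : pure (b + b') m = pure b m + pure b' m.
Proof.
rewrite -[RHS]/(tadd _ _) tadd_class; apply/tens_classP; exact: tens_addl.
Qed.
Lemma pureDr b m m' : pure b (m + m') = pure b m + pure b m'.
Proof.
rewrite -[RHS]/(tadd _ _) tadd_class; apply/tens_classP; exact: tens_addr.
Qed.
Lemma pure_bal b a m : pure (rmulact b a) m = pure b (a *: m).
Proof. by apply/tens_classP; apply: tens_bal. Qed.

Section Lift.
Variables (Z : zmodType) (phi : B -> M -> Z).

Definition balanced : Prop :=
  [/\ forall b b' m, phi (b + b') m = phi b m + phi b' m,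
      forall b m m', phi b (m + m') = phi b m + phi b m'
    & forall b a m, phi (rmulact b a) m = phi b (a *: m)].

Definition tlift (x : tensor) : Z := \sum_(p <- tens_repr x) phi p.1 p.2.

Hypothesis phiP : balanced.

Lemma tens_rel_sum s t : tens_rel s t ->
  \sum_(p <- s) phi p.1 p.2 = \sum_(p <- t) phi p.1 p.2.
Proof.
have [Dl Dr bal] := phiP.
elim=> //= {s t}.
- by move=> s t u _ -> _ ->.
- by move=> s s' t t' _ es _ et; rewrite !big_cat /= es et.
- by move=> s t; rewrite !big_cat /= addrC.
- move=> m; rewrite big_seq1 big_nil /=.
  by apply: (addrI (phi 0 m)); rewrite -Dl !addr0.
- by move=> b b' m; rewrite !big_cons !big_nil /= Dl !addr0.
- by move=> b m m'; rewrite !big_cons !big_nil /= Dr !addr0.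
- by move=> b a m; rewrite !big_seq1 /= bal.
Qed.

Lemma tlift_class s : tlift (tens_class s) = \sum_(p <- s) phi p.1 p.2.
Proof. exact/tens_rel_sum/tens_reprK. Qed.

Lemma tlift_pure b m : tlift (pure b m) = phi b m.
Proof. by rewrite tlift_class big_seq1. Qed.

Lemma tliftD x y : tlift (x + y) = tlift x + tlift y.
Proof. by rewrite -[x + y]/(tadd x y) tlift_class big_cat. Qed.

Lemma tlift_unique (f : tensor -> Z) : {morph f : x y / x + y} ->
  (forall b m, f (pure b m) = phi b m) -> f =1 tlift.
Proof.
move=> fD fp x.
have f0 : f 0 = 0 by apply: (addrI (f 0)); rewrite -fD !addr0.
rewrite {1}(tensE x) (big_morph f fD f0); apply: eq_bigr => p _; exact: fp.
Qed.
End Lift.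

Lemma tens_ext (Z : zmodType) (f g : tensor -> Z) :
  {morph f : x y / x + y} -> {morph g : x y / x + y} ->
  (forall b m, f (pure b m) = g (pure b m)) -> f =1 g.
Proof.
move=> fD gD fg x.
have f0 : f 0 = 0 by apply: (addrI (f 0)); rewrite -fD !addr0.
have g0 : g 0 = 0 by apply: (addrI (g 0)); rewrite -gD !addr0.
rewrite (tensE x) (big_morph f fD f0) (big_morph g gD g0).
by apply: eq_bigr => p _; apply: fg.
Qed.

Definition tscale (a : A) : tensor -> tensor := tlift (fun b m => pure (a *: b) m).

Fact tscale_balanced a : balanced (fun b m => pure (a *: b) m).
Proof.
split=> [b b' m|b m m'|b c m]; first by rewrite scalerDr pureDl.
  by rewrite pureDr.
by rewrite -lractA pure_bal.
Qed.

Lemma tscale_pure a b m : tscale a (pure b m) = pure (a *: b) m.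
Proof. exact: tlift_pure (tscale_balanced a) b m. Qed.

Fact tscaleDr : right_distributive tscale +%R.
Proof. by move=> a; apply: tliftD; apply: tscale_balanced. Qed.
Fact tscaleA a a' x : tscale a (tscale a' x) = tscale (a * a') x.
Proof.
move: x; apply: tens_ext => [x y|x y|b m]; rewrite ?tscaleDr//.
by rewrite !tscale_pure scalerA.
Qed.
Fact tscale1 : left_id 1 tscale.
Proof.
by apply: tens_ext => [x y|x y|b m] //; rewrite ?tscaleDr// tscale_pure scale1r.
Qed.
Fact tscaleDl x : {morph tscale^~ x : a a' / a + a'}.
Proof.
move=> a a'; move: x; apply: tens_ext => [x y|x y|b m]; rewrite ?tscaleDr//.
  by rewrite addrACA.
by rewrite !tscale_pure scalerDl pureDl.
Qed.

HB.instance Definition _ :=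
  GRing.Zmodule_isLmodule.Build A tensor tscaleA tscale1 tscaleDr tscaleDl.

Lemma scale_pure (a : A) b m : a *: pure b m = pure (a *: b) m.
Proof. exact: tscale_pure. Qed.
End Tensor.

Section TensorFunctor.
Variables (k : fieldType) (A : falgType k) (B : bimodule A).

Definition tmap (M N : lmodType A) (f : modhom M N) : tensor B M -> tensor B N :=
  tlift (fun b m => pure b (f m)).

Fact tmap_balanced (M N : lmodType A) (f : modhom M N) :
  balanced (fun (b : B) m => pure b (f m)).
Proof.
split=> [b b' m|b m m'|b a m]; first by rewrite pureDl.
  by rewrite linearD pureDr.
by rewrite linearZ pure_bal.
Qed.

Lemma tmap_pure (M N : lmodType A) (f : modhom M N) (b : B) m :
  tmap f (pure b m) = pure b (f m).
Proof. exact: tlift_pure (tmap_balanced f) b m. Qed.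

Lemma tmapD (M N : lmodType A) (f : modhom M N) : {morph tmap f : x y / x + y}.
Proof. exact: tliftD (tmap_balanced f). Qed.

Fact tmap_linear (M N : lmodType A) (f : modhom M N) : linear (tmap f).
Proof.
move=> a x y; rewrite tmapD; congr (_ + _); move: x.
apply: tens_ext => [x z|x z|b m]; rewrite ?tmapD ?scalerDr ?tmapD//.
by rewrite scale_pure !tmap_pure scale_pure.
Qed.

Definition tmapL (M N : lmodType A) (f : modhom M N) :
  modhom (tensor B M) (tensor B N) := mk_modhom (tmap_linear f).

Hypothesis Bfg : bimodule_fg B.

Lemma fg_tensor (M : lmodType A) :
  finitely_generated M -> finitely_generated (tensor B M).
Proof.
move=> [m [h hP]]; have [n [g gP]] := Bfg.
pose e := vbasis {:A}.
pose G (i : 'I_n * 'I_(\dim {:A}) * 'I_m) : tensor B M :=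
  pure (g i.1.1) (e`_(i.1.2) *: h i.2).
pose S x := exists a, x = \sum_i a i *: G i.
have S0 : S 0 by exists (fun=> 0); rewrite big1// => i _; rewrite scale0r.
have SD x y : S x -> S y -> S (x + y).
  move=> [a ->] [b ->]; exists (fun i => a i + b i); rewrite -big_split.
  by apply: eq_bigr => i _; rewrite scalerDl.
have SZ a x : S x -> S (a *: x).
  move=> [b ->]; exists (fun i => a * b i); rewrite scaler_sumr.
  by apply: eq_bigr => i _; rewrite scalerA.
have SG i : S (G i).
  exists (fun j => (j == i)%:R); rewrite (bigD1 i)//= eqxx scale1r.
  by rewrite big1 ?addr0// => j /negPf->; rewrite scale0r.
have Ssum (I : finType) (f : I -> tensor B M) : (forall i, S (f i)) -> S (\sum_i f i).
  by move=> fS; apply: big_ind.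
have pl (y : M) : {morph (fun b : B => pure b y) : b b' / b + b'}.
  by move=> b b'; apply: pureDl.
have pl0 (y : M) : pure (0 : B) y = 0.
  by apply: (addrI (pure 0 y)); rewrite -pl !addr0.
have pr (b : B) : {morph (fun y : M => pure b y) : y z / y + z}.
  by move=> y z; apply: pureDr.
have pr0 (b : B) : pure b (0 : M) = 0.
  by apply: (addrI (pure b 0)); rewrite -pr !addr0.
apply: (@fg_finType _ _ _ _ G) => x; rewrite -/(S x) (tensE x).
apply: big_ind => // -[b y] _ /=.
have [r [j [a [a' ->]]]] := gP b.
rewrite (big_morph _ (pl y) (pl0 y)); apply: (Ssum) => i.
rewrite -scale_pure pure_bal; apply: (SZ).
have [c ->] := hP (a' i *: y).
rewrite (big_morph _ (pr _) (pr0 _)); apply: (Ssum) => l.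
rewrite (coord_vbasis (memvf (c l))) scaler_suml.
rewrite (big_morph _ (pr _) (pr0 _)); apply: (Ssum) => q.
rewrite -mulr_algl -scalerA -pure_bal ract_scalar -scale_pure.
exact: SZ (SG (j i, q, l)).
Qed.

Definition tensor_fg (M : fgmodule A) : fgmodule A := FGModule (fg_tensor (fgP M)).

Fact tensor_fmap1 (M : Amod A) :
  tmapL (mhid M) = mhid (tensor_fg M).
Proof.
by apply: modhom_ext; apply: tens_ext => //= [|b m]; [apply: tmapD | rewrite tmap_pure].
Qed.

Fact tensor_fmapM (M N P : Amod A) (g : arrow N P) (f : arrow M N) :
  tmapL (mhcomp g f) = mhcomp (tmapL g) (tmapL f).
Proof.
apply: modhom_ext; apply: tens_ext => /= [|x y|b m]; first exact: tmapD.
  by rewrite !tmapD.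
by rewrite !tmap_pure.
Qed.

Definition tensor_functor : functor (Amod A) (Amod A) :=
  @Functor (Amod A) (Amod A) tensor_fg (fun M N f => tmapL f) tensor_fmap1 tensor_fmapM.
End TensorFunctor.

Definition tensor_representable (k : fieldType) (A : falgType k)
    (F : functor (Amod A) (Amod A)) (B : bimodule A) (Bfg : bimodule_fg B) : Prop :=
  naturally_isomorphic F (tensor_functor Bfg).

(* Main.v *)
Require Import Defs.
From mathcomp Require Import all_boot all_order all_algebra all_field.
From mathcomp Require Import boolp.

(** An object of [Lcat F] uses [F] only through the sources of its structure
    maps [F (M n) -> M (n + 1)]. A natural transformation [theta : G => F]
    therefore turns it into an object of [Lcat G] with the same underlying
    family, by precomposing each structure map with [theta]; naturality of
    [theta] gives both the square-zero condition and the fact that a family of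
    arrows which is a morphism before this operation is still one after it. The
    resulting functor [twist theta_nat : Lcat F -> Lcat G] moves neither the
    underlying families nor the components of morphisms.

    If [F] and [G] are naturally isomorphic, twisting along the isomorphism and
    then along its inverse replaces a structure map [d] by [d \oc theta \oc eta],
    which is [d] itself. Hence the two twists are inverse on the nose, and the
    categories are isomorphic rather than merely equivalent. The theorem is the
    case where [G] is the functor [B (x) -].

    Since the twists compose to the identity on objects only propositionally,
    comparing their effect on morphisms takes a transport along equalities of
    objects; [functor_eq_id] and [Lmor_cast] isolate it. *)

Local Open Scope ring_scope.
Local Open Scope cat_scope.

Set Implicit Arguments.
Unset Strict Implicit.
Unset Printing Implicit Defensive.

Definition arrow_cast (C : category) (X X' Y Y' : C) (eX : X = X') (eY : Y = Y')
    (f : arrow X Y) : arrow X' Y' :=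
  match eX in _ = X0, eY in _ = Y0 return arrow X0 Y0 with
  | erefl, erefl => f
  end.

Lemma functor_eq_id (C : category) (K : functor C C) (eK : forall X, K X = X) :
  (forall X Y (f : arrow X Y), arrow_cast (eK X) (eK Y) (fmap K f) = f) ->
  K = idF C.
Proof.
case: K eK => o m m1 mM /= eK.
have eo : (fun X => X) = o by apply: funext => X; rewrite eK.
case: o / eo m m1 mM eK => m m1 mM eK mK.
have em : (fun X Y f => f) = m.
  do 3![apply: functional_extensionality_dep => ?].
  rewrite -[LHS]mK.
  by rewrite (Prop_irrelevance (eK _) erefl) (Prop_irrelevance (eK _) erefl).
by case: m / em m1 mM {mK} => m1 mM; congr Functor; apply: Prop_irrelevance.
Qed.

Lemma comp0arrow (C : additiveCategory) (X Y Z : C) (f : addarrow X Y) :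
  acomp (0 : addarrow Y Z) f = 0.
Proof. by apply: (GRing.addrI (acomp 0 f)); rewrite -acompDl !GRing.addr0. Qed.

Lemma LObj_eq (C : additiveCategory) (F : functor C C) (M : int -> C)
    (d d' : forall n, arrow (F (M n)) (M (n + 1))) dK dK' :
  (forall n, d n = d' n) -> LObj (Ld := d) dK = LObj (Ld := d') dK'.
Proof.
move=> dd'; have e : d = d' by apply: functional_extensionality_dep.
by case: d' / e dK' {dd'} => dK'; congr LObj; apply: Prop_irrelevance.
Qed.

(** The source and target of the transport have the same underlying families,
    so the components of [f] before and after have the same types and can be
    compared directly. Equality of objects does not by itself give back equality
    of the structure maps over a fixed family; with the pointwise hypotheses the
    two sides of [eM] and of [eN] become identical, and proof irrelevance turns
    the transport into the identity. *)
Lemma Lmor_cast (C : additiveCategory) (F : functor C C) (M N : int -> C)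
    (dM dM' : forall n, arrow (F (M n)) (M (n + 1)))
    (dN dN' : forall n, arrow (F (N n)) (N (n + 1))) dMK dMK' dNK dNK'
    (eM : LObj (Ld := dM) dMK = LObj (Ld := dM') dMK' :> Lcat F)
    (eN : LObj (Ld := dN) dNK = LObj (Ld := dN') dNK' :> Lcat F) f n :
  (forall i, dM i = dM' i) -> (forall i, dN i = dN' i) ->
  Lmor (arrow_cast eM eN f) n = Lmor f n.
Proof.
move=> ddM ddN.
have e : dM = dM' by apply: functional_extensionality_dep.
case: dM' / e dMK' eM {ddM} => dMK' eM.
have e : dN = dN' by apply: functional_extensionality_dep.
case: dN' / e dNK' eN {ddN} => dNK' eN.
move: eM eN; rewrite (Prop_irrelevance dMK' dMK) (Prop_irrelevance dNK' dNK).
by move=> eM eN; rewrite (Prop_irrelevance eM erefl) (Prop_irrelevance eN erefl).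
Qed.

Definition natural (C D : category) (F G : functor C D)
    (theta : forall X, arrow (F X) (G X)) : Prop :=
  forall X Y (f : arrow X Y), theta Y \oc fmap F f = fmap G f \oc theta X.

Lemma natural_inverse (C D : category) (F G : functor C D)
    (eta : forall X, arrow (F X) (G X)) (theta : forall X, arrow (G X) (F X)) :
  natural eta -> (forall X, theta X \oc eta X = idarr (F X)) ->
  (forall X, eta X \oc theta X = idarr (G X)) -> natural theta.
Proof.
move=> eta_nat etaK thetaK X Y f.
rewrite -[fmap G f]ccompm1 -thetaK [fmap G f \oc _]ccompA -eta_nat.
by rewrite !ccompA etaK ccomp1m.
Qed.

Section Twist.
Variables (C : additiveCategory) (F G : functor C C).
Variable theta : forall X, arrow (G X) (F X).
Hypothesis theta_nat : natural theta.

Fact twist_LdK (M : Lobj F) (n : int) :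
  (Ld M (n + 1) \oc theta (M (n + 1))) \oc fmap G (Ld M n \oc theta (M n))
  = 0 :> addarrow (G (G (M n))) (M (n + 1 + 1)).
Proof.
rewrite -ccompA theta_nat fmapM !ccompA LdK.
by rewrite -ccompA; apply: comp0arrow.
Qed.

Definition twist_obj (M : Lobj F) : Lobj G := LObj (twist_LdK M).

Fact twist_LmorP (M N : Lobj F) (f : Lhom M N) (n : int) :
  f (n + 1) \oc (Ld M n \oc theta (M n))
  = (Ld N n \oc theta (N n)) \oc fmap G (f n).
Proof. by rewrite ccompA LmorP -!ccompA theta_nat. Qed.

Definition twist_hom (M N : Lobj F) (f : Lhom M N) :
    Lhom (twist_obj M) (twist_obj N) :=
  LHom (M := twist_obj M) (N := twist_obj N) (twist_LmorP f).

Fact twist_fmap1 (M : Lcat F) : twist_hom (idarr M) = idarr (twist_obj M : Lcat G).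
Proof. exact: Lhom_ext. Qed.

Fact twist_fmapM (M N P : Lcat F) (g : arrow N P) (f : arrow M N) :
  twist_hom (g \oc f) = (twist_hom g : arrow (twist_obj N : Lcat G) _) \oc twist_hom f.
Proof. exact: Lhom_ext. Qed.

Definition twist : functor (Lcat F) (Lcat G) :=
  @Functor (Lcat F) (Lcat G) twist_obj twist_hom twist_fmap1 twist_fmapM.
End Twist.

(** Twisting by [theta] and then by [eta] changes a structure map [d] to
    [(d \oc theta) \oc eta], and the composite [theta \oc eta] cancels. *)
Lemma twistK (C : additiveCategory) (F G : functor C C)
    (eta : forall X, arrow (F X) (G X)) (theta : forall X, arrow (G X) (F X))
    (eta_nat : natural eta) (theta_nat : natural theta) :
  (forall X, theta X \oc eta X = idarr (F X)) ->
  compF (twist eta_nat) (twist theta_nat) = idF (Lcat F).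
Proof.
move=> etaK.
have dK (M : Lobj F) n : (Ld M n \oc theta (M n)) \oc eta (M n) = Ld M n.
  by rewrite -ccompA etaK ccompm1.
have oK (M : Lcat F) : compF (twist eta_nat) (twist theta_nat) M = M.
  by case: M (dK M) => M d dd dK'; apply: LObj_eq.
apply: (functor_eq_id (eK := oK)) => M N f; apply: Lhom_ext => n.
move: (oK M) (oK N) (dK M) (dK N).
by case: M N f => [M dM dMK] [N dN dNK] f *; apply: Lmor_cast.
Qed.

Lemma isomorphic_Lcat (C : additiveCategory) (F G : functor C C) :
  naturally_isomorphic F G -> isomorphic_categories (Lcat F) (Lcat G).
Proof.
move=> [eta [theta [eta_nat etaK thetaK]]].
have theta_nat := natural_inverse eta_nat etaK thetaK.
by exists (twist theta_nat), (twist eta_nat); split; apply: twistK.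
Qed.

Theorem theorem6p12 (k : closedFieldType) (k_char0 : [pchar k] =i pred0)
    (A : falgType k) (F : functor (Amod A) (Amod A))
    (F_lin : klinear_functor F) (F_rex : right_exact F)
    (B : bimodule A) (B_fg : bimodule_fg B)
    (F_rep : tensor_representable F B_fg) :
  isomorphic_categories (Lcat F) (Lcat (tensor_functor B_fg)).
Proof. exact: isomorphic_Lcat. Qed.
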